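(* Let $\mathcal H$ be a semifilter on $\omega$ such that for every finite-to-one surjection $\phi:\omega\to\omega$ there exists $X\subset\omega$ with $\phi^{-1}[X]\in\mathcal H$ and $\phi^{-1}[\omega\setminus X]\in\mathcal H$. Then $\mathcal H^2=\mathcal H\times\mathcal H$ is not Menger and $\mathcal H$ is not Scheepers. In particular, there is no continuous surjection from $\mathcal H$ onto $\mathcal H^2$.
   Context: $\mathcal P(\omega)$ is identified with the Cantor space $2^\omega$ via characteristic functions, and subsets of $\mathcal P(\omega)$ carry the subspace topology. A semifilter on $\omega$ is a family $\mathcal H\subset[\omega]^\omega$ such that for all $H\in\mathcal H$, $n\in\omega$ and $X\subset\omega$ with $X\supset H\setminus n$ we have $X\in\mathcal H$ (here $n=\{0,\dots,n-1\}$). A topological space $X$ is Menger if for every sequence $\langle \mathcal U_n:n\in\omega\rangle$ of open covers of $X$ there are finite $\mathcal V_n\subset\mathcal U_n$ such that $\{\bigcup\mathcal V_n:n\in\omega\}$ covers $X$. The space $X$ is Scheepers if for every such sequence there are finite $\mathcal V_n\subset\mathcal U_n$ such that $\{\bigcup\mathcal V_n:n\in\omega\}$ is an $\omega$-cover of $X$, i.e., for every finite $F\subset X$ the set $\{n\in\omega:F\subset\bigcup\mathcal V_n\}$ is infinite.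
   Formalization: The last sentence (no continuous surjection from H onto H^2) is stated only for Menger H; without this it is false, since H = [ω]^ω satisfies the hypotheses and is homeomorphic to the Baire space, hence to its own square. *)

(* Defs.v *)
From HB Require Import structures.
From mathcomp Require Import all_boot all_order all_algebra.
From mathcomp Require Import all_classical all_reals all_analysis.

Set Implicit Arguments.
Unset Strict Implicit.
Unset Printing Implicit Defensive.

Local Open Scope classical_set_scope.

Definition charfun (A : set nat) : cantor_space := fun n => n \in A.

(* A family of subsets of nat carries the topology it inherits from 2^nat
   when sets are identified with their characteristic functions; on the
   sigma type [set_type] this is the initial topology of the inclusion. *)
Definition family_space (H : set (set nat)) : topologicalType :=
  set_type (charfun @` H).

Definition semifilter (H : set (set nat)) : Prop :=
  (forall A, H A -> infinite_set A) /\
  (forall A n X, H A -> A `\` `I_n `<=` X -> H X).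

Definition finite_to_one (phi : nat -> nat) : Prop :=
  forall n, finite_set (phi @^-1` [set n]).

Definition open_cover (X : topologicalType) (U : set (set X)) : Prop :=
  (forall O, U O -> open O) /\ \bigcup_(O in U) O = [set: X].

Definition menger (X : topologicalType) : Prop :=
  forall U : nat -> set (set X), (forall n, open_cover (U n)) ->
  exists V : nat -> set (set X),
    (forall n, finite_set (V n) /\ V n `<=` U n) /\
    \bigcup_n \bigcup_(O in V n) O = [set: X].

(* Occurrences are counted by index n, so that a union repeated along
   infinitely many indices counts infinitely often. *)
Definition scheepers (X : topologicalType) : Prop :=
  forall U : nat -> set (set X), (forall n, open_cover (U n)) ->
  exists V : nat -> set (set X),
    (forall n, finite_set (V n) /\ V n `<=` U n) /\
    forall F : set X, finite_set F ->
      infinite_set [set n | F `<=` \bigcup_(O in V n) O].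

(* Main.v *)
(** For open sets [O n j] increasing in [j] and covering the space for each [n],
    a covering property gives [g] such that the sets [O n (g n)] cover (for
    Scheepers, such that each finite set lies in some [O n (g n)]).  Cut [nat]
    into consecutive blocks so long that [[n, g n)] always meets at most two of
    them.  When [A] and [B] are unions of blocks with complementary index sets,
    no [[n, g n)] contains [x < y < z] with [x], [z] in [A] and [y] in [B], as
    this would need three blocks; since the members of [H] are infinite, such
    triples give covers of [H * H], which is therefore not Menger.  For
    Scheepers, merge the blocks in pairs in two ways, indices [2i, 2i + 1] or
    [2i - 1, 2i], which gives split pairs [A, B] and [A', B']: an interval
    [[n, g n)] that meets all four sets crosses both kinds of pair boundary,
    hence meets three blocks. *)
Require Import Defs.
From mathcomp Require Import all_boot all_order all_algebra.
From mathcomp Require Import all_classical all_reals all_analysis.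
From mathcomp Require Import zify.

Set Implicit Arguments.
Unset Strict Implicit.

Local Open Scope classical_set_scope.

(** A finite choice from an increasing sequence thus costs only one number: the largest index
    chosen. *)
Lemma finite_subset_range_nondecreasing (X : Type) (O : nat -> set X)
    (V : set (set X)) :
  {homo O : i j / (i <= j)%N >-> i `<=` j} ->
  finite_set V -> V `<=` range O ->
  exists j, \bigcup_(W in V) W `<=` O j.
Proof.
move=> Omono finV VO.
have [s Vs] : exists s : seq nat, V `<=` O @` [set` s].
  move/finite_seqP: finV VO => [t ->]; elim: t => [|W t IH] tO.
    by exists [::] => W.
  have [|s ts] := IH; first by move=> Z Zt; apply: tO; rewrite /= inE Zt orbT.
  have [j _ OjW] : range O W by apply: tO; rewrite /= inE eqxx.
  exists (j :: s) => Z /=; rewrite inE => /orP[/eqP ->|/ts [i si <-]].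
    by exists j => //=; rewrite inE eqxx.
  by exists i => //=; rewrite inE; apply/orP; right.
exists (\max_(i <- s) i)%N => x [W /Vs [i /= si <-]].
by apply: Omono; apply: leq_bigmax_seq.
Qed.

Lemma open_cover_range (X : topologicalType) (O : nat -> set X) :
  (forall j, open (O j)) -> (forall x, exists j, O j x) -> open_cover (range O).
Proof.
move=> Oopen Ocov; split; first by move=> _ [j _ <-].
rewrite -subTset => x _; have [j Ojx] := Ocov x.
by exists (O j) => //; exists j.
Qed.

Section bounding.
Variables (X : topologicalType) (O : nat -> nat -> set X).
Hypothesis O_open : forall n j, open (O n j).
Hypothesis O_cover : forall n x, exists j, O n j x.
Hypothesis O_mono : forall n, {homo O n : i j / (i <= j)%N >-> i `<=` j}.

Lemma menger_bound : menger X -> exists g, forall x, exists n, O n (g n) x.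
Proof.
move=> /(_ (fun n => range (O n)) (fun n => open_cover_range (O_open n) (O_cover n))).
move=> [V [finV Vcov]].
have /choice[g gP] n : exists j, \bigcup_(W in V n) W `<=` O n j.
  by have [? ?] := finV n; exact: finite_subset_range_nondecreasing.
exists g => x; have : [set: X] x by [].
by rewrite -Vcov => -[n _ Vnx]; exists n; exact: gP.
Qed.

Lemma scheepers_bound : scheepers X ->
  exists g, forall F, finite_set F -> exists n, F `<=` O n (g n).
Proof.
move=> /(_ (fun n => range (O n)) (fun n => open_cover_range (O_open n) (O_cover n))).
move=> [V [finV Vcov]].
have /choice[g gP] n : exists j, \bigcup_(W in V n) W `<=` O n j.
  by have [? ?] := finV n; exact: finite_subset_range_nondecreasing.
exists g => F /Vcov /infinite_setN0[n FV].
by exists n; exact: subset_trans FV (gP n).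
Qed.

End bounding.

(** Covers of [Y] are pulled back along [f], and a selection made in [X] is carried back to [Y].
    This rules out a continuous surjection onto a square that is not Menger. *)
Lemma menger_surj (X Y : topologicalType) (f : X -> Y) :
  continuous f -> set_surj setT setT f -> menger X -> menger Y.
Proof.
move=> /continuousP fcont fsurj mX U Ucov.
have [|V [finV Vcov]] := mX (fun n => (fun W => f @^-1` W) @` U n).
  move=> n; have [Uopen UT] := Ucov n; split.
    by move=> _ [W UW <-]; apply: fcont; exact: Uopen.
  rewrite -subTset => x _; have : [set: Y] (f x) by [].
  by rewrite -UT => -[W UW Wfx]; exists (f @^-1` W) => //; exists W.
(* Distinct members of [U n] may have the same preimage, so [h] fixes one for each index and
   selected preimage; elsewhere its value is the dummy [setT]. *)
have /choice[h hP] (p : nat * set X) :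
    exists W, V p.1 p.2 -> U p.1 W /\ f @^-1` W = p.2.
  have [Vp|nVp] := pselect (V p.1 p.2); last by exists setT.
  by have [W UW fW] := (finV p.1).2 _ Vp; exists W.
exists (fun n => (fun W => h (n, W)) @` V n); split.
  move=> n; split; first by apply: finite_image; exact: (finV n).1.
  by move=> _ [W VW <-]; exact: (hP (n, W) VW).1.
rewrite -subTset => y _; have [x _ <-] := fsurj y I.
have : [set: X] x by [].
rewrite -Vcov => -[n _ [W VW Wx]]; exists n => //.
exists (h (n, W)); first by exists W.
by have [_ /= fW] := hP (n, W) VW; rewrite -fW in Wx.
Qed.

(** Here [psi x] is the index of the block [[k i, k i.+1)] containing [x]. If [n] is in block [i],
    then [n <= k i.+1], hence [g n <= G (k i.+1) <= k i.+2], and [[n, g n)] stops before block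
    [i.+2]. *)
Lemma exists_long_blocks (g : nat -> nat) : exists psi : nat -> nat,
  [/\ {homo psi : x y / (x <= y)%N}, finite_to_one psi,
      set_surj [set: nat] [set: nat] psi &
      forall n x, (x < g n)%N -> (psi x <= (psi n).+1)%N].
Proof.
pose G n := (\sum_(i < n.+1) g i)%N.
have gG n m : (n <= m)%N -> (g n <= G m)%N.
  by move=> nm; rewrite /G (bigD1 (Ordinal (nm : (n < m.+1)%N))) //= leq_addr.
(* The term [(k i').+1] keeps every block nonempty, so that [psi] is onto. *)
pose k := fix k i := if i is i'.+1 then maxn (k i').+1 (G (k i')) else 0.
have k_lt : {homo k : i j / (i < j)%N}.
  by apply: homo_ltn; [exact: ltn_trans|move=> i; rewrite /= leq_maxl].
have k_le : {homo k : i j / (i <= j)%N} by exact: ltnW_homo.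
have /choice[psi psiP] x : exists i, (k i <= x < k i.+1)%N.
  elim: x => [|x [i /andP[ix xi]]]; first by exists 0; rewrite /= leq_maxl.
  have [xi'|ix'] := ltnP x.+1 (k i.+1); first by exists i; rewrite xi' leqW.
  by exists i.+1; rewrite ix' (leq_trans _ (k_lt _ _ (ltnSn i.+1))).
have psi_lt x i : (x < k i)%N -> (psi x < i)%N.
  have /andP[kx _] := psiP x; apply: contraTltn => /k_le ik.
  by rewrite -leqNgt (leq_trans ik).
exists psi; split.
- move=> x y xy; rewrite -ltnS; apply: psi_lt.
  by have /andP[_] := psiP y; exact: leq_ltn_trans.
- move=> n; apply: (sub_finite_set _ (finite_II (k n.+1))) => x /= <-.
  by have /andP[] := psiP x.
- move=> i _; exists (k i) => //.
  have /andP[ki ik] := psiP (k i); apply/eqP; rewrite eqn_leq.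
  rewrite -ltnS psi_lt ?k_lt //= leqNgt; apply/negP => /k_le.
  by rewrite leqNgt ik.
- move=> n x xg; rewrite -ltnS; apply: psi_lt.
  have /andP[_ /ltnW nk] := psiP n.
  by rewrite (leq_trans xg) // (leq_trans (gG _ _ nk)) // leq_maxr.
Qed.

Lemma infinite_set_nat_ge (A : set nat) n :
  infinite_set A -> exists2 x, A x & (n <= x)%N.
Proof.
move=> infA; have [x [Ax nx]] : A `\` `I_n !=set0.
  by apply: infinite_setN0; exact: infinite_setD.
by exists x => //; rewrite leqNgt; apply/negP.
Qed.

Section family.
Variable H : set (set nat).

Definition member_point (A : set nat) (HA : H A) : family_space H :=
  SigSub (mem_set (ex_intro2 _ _ A HA erefl)).

Definition containing (m : nat) : set (family_space H) := 
  [set p | (set_val p : cantor_space) m].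

Lemma member_pointE (A : set nat) (HA : H A) m :
  containing m (member_point HA) = A m.
Proof. by rewrite /containing /= /charfun in_setE. Qed.

Lemma containing_open m : open (containing m).
Proof.
apply: (@open_comp _ _ (set_val : family_space H -> cantor_space) [set f | f m]).
  by move=> p _; exact: initial_continuous.
apply: (@open_comp _ _ (fun f : cantor_space => f m : bool) [set b | b]).
  by move=> f _; exact: (@proj_continuous nat (fun=> bool) m).
exact: discrete_open.
Qed.

Lemma containing_ge (semiH : semifilter H) (p : family_space H) n :
  exists2 x, containing x p & (n <= x)%N.
Proof.
have [A HA Ap] := set_valP p.
have [x Ax nx] := infinite_set_nat_ge n (semiH.1 _ HA); exists x => //.
have -> : containing x p = charfun A x by rewrite Ap.
by rewrite /charfun in_setE.
Qed.

End family.

Section main.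
Variable H : set (set nat).
Hypothesis semiH : semifilter H.
Hypothesis splitH : forall phi : nat -> nat,
  finite_to_one phi -> set_surj [set: nat] [set: nat] phi ->
  exists X : set nat, H (phi @^-1` X) /\ H (phi @^-1` (~` X)).

Lemma split_semifilter_square_not_menger :
  ~ menger (family_space H * family_space H)%type.
Proof.
pose X : topologicalType := (family_space H * family_space H)%type.
(* Triples [x < y < z] in [[n, j)]; in [O n j] the first coordinate of the pair contains [x] and
   [z], the second contains [y]. *)
pose T n j := [set t : nat * nat * nat |
  [&& n <= t.1.1, t.1.1 < t.1.2, t.1.2 < t.2 & t.2 < j]%N].
pose O n j : set X := \bigcup_(t in T n j)
  (fst @^-1` containing t.1.1 `&` snd @^-1` containing t.1.2
   `&` fst @^-1` containing t.2).
have fst_cont : continuous (fst : X -> family_space H).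
  by move=> ?; exact: cvg_fst.
have snd_cont : continuous (snd : X -> family_space H).
  by move=> ?; exact: cvg_snd.
have Oopen n j : open (O n j).
  apply: bigcup_open => t _; apply: openI; first apply: openI.
  - by move/continuousP: fst_cont; apply; exact: containing_open.
  - by move/continuousP: snd_cont; apply; exact: containing_open.
  - by move/continuousP: fst_cont; apply; exact: containing_open.
have Ocov n p : exists j, O n j p.
  have [x px nx] := containing_ge semiH p.1 n.
  have [y py xy] := containing_ge semiH p.2 x.+1.
  have [z pz yz] := containing_ge semiH p.1 y.+1.
  by exists z.+1, (x, y, z) => //=; rewrite /T /= nx xy yz ltnSn.
have Omono n : {homo O n : i j / (i <= j)%N >-> i `<=` j}.
  move=> i j ij p [t /and4P[? ? ? ti] Ot]; exists t => //.
  by apply/and4P; split=> //; exact: leq_trans ij.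
move=> /(menger_bound Oopen Ocov Omono)[g gP].
have [psi [psi_mono fin_psi surj_psi psi_g]] := exists_long_blocks g.
have [S [HA HB]] := splitH fin_psi surj_psi.
have [n [[[x y] z] /and4P[/= nx xy yz zg]]] :=
  gP (member_point HA, member_point HB).
rewrite /= !member_pointE => -[[Sx Sy] Sz].
(* Membership in [S] changes twice from [x] to [z], so the monotone [psi] rises at least twice,
   while [psi z <= (psi n).+1] leaves room for one rise only. *)
have neq_xy : psi x <> psi y by move=> e; apply: Sy; rewrite -e.
have neq_yz : psi y <> psi z by move=> e; apply: Sy; rewrite e.
have := psi_mono _ _ nx; have := psi_mono _ _ (ltnW xy).
have := psi_mono _ _ (ltnW yz); have := psi_g _ _ zg.
lia.
Qed.

Lemma split_semifilter_not_scheepers : ~ scheepers (family_space H).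
Proof.
pose O n j : set (family_space H) :=
  \bigcup_(x in [set x | n <= x < j]%N) containing x.
have Oopen n j : open (O n j).
  by apply: bigcup_open => x _; exact: containing_open.
have Ocov n p : exists j, O n j p.
  have [x px nx] := containing_ge semiH p n.
  by exists x.+1, x => //=; rewrite nx ltnSn.
have Omono n : {homo O n : i j / (i <= j)%N >-> i `<=` j}.
  move=> i j ij p [x /andP[nx xi] px]; exists x => //.
  by apply/andP; split=> //; exact: leq_trans ij.
move=> /(scheepers_bound Oopen Ocov Omono)[g gP].
have [psi [psi_mono fin_psi surj_psi psi_g]] := exists_long_blocks g.
(* The bound on [h] holds for both ways of pairing blocks, [./2] and [uphalf], and makes the fibres
   of [h] finite. *)
have fin_half (h : nat -> nat) : (forall i, i <= (h i).*2.+1)%N ->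
    finite_to_one (fun x => h (psi x)).
  move=> hP n; have -> : (fun x => h (psi x)) @^-1` [set n] =
      \bigcup_(i in [set i | h i = n]) psi @^-1` [set i].
    by apply/seteqP; split=> [x /= <-|x [i /= <- <-]] //; exists (psi x).
  apply: bigcup_finite => //.
  apply: (sub_finite_set _ (finite_II n.*2.+2)) => i /= <-.
  by rewrite ltnS.
have [S [HA HB]] : exists S, H ((fun x => (psi x)./2) @^-1` S) /\
    H ((fun x => (psi x)./2) @^-1` (~` S)).
  apply: splitH; first by apply: fin_half => i; lia.
  move=> i _; have [x _ xi] := surj_psi i.*2 I.
  by exists x => //; rewrite xi doubleK.
have [S' [HA' HB']] : exists S, H ((fun x => uphalf (psi x)) @^-1` S) /\
    H ((fun x => uphalf (psi x)) @^-1` (~` S)).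
  apply: splitH; first by apply: fin_half => i; lia.
  move=> i _; have [x _ xi] := surj_psi i.*2 I.
  by exists x => //; rewrite xi uphalf_double.
(* Taking all four points at once gives one interval [[n, g n)] that serves both splittings. *)
have [|n Fn] := gP ([set member_point HA; member_point HB] `|`
                    [set member_point HA'; member_point HB']).
  by rewrite !finite_setU; do !split; exact: finite_set1.
have window (A : set nat) (HA0 : H A) : O n (g n) (member_point HA0) ->
    exists x, A x /\ (psi n <= psi x <= (psi n).+1)%N.
  move=> [x /andP[nx xg]]; rewrite member_pointE => Ax.
  by exists x; rewrite psi_mono // psi_g.
have [|a [Sa ?]] := window _ HA; first by apply: Fn; left; left.
have [|b [Sb ?]] := window _ HB; first by apply: Fn; left; right.
have [|a' [Sa' ?]] := window _ HA'; first by apply: Fn; right; left.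
have [|b' [Sb' ?]] := window _ HB'; first by apply: Fn; right; right.
(* All four block indices are [psi n] or [(psi n).+1]. These two have the same [./2] if [psi n] is
   even and the same [uphalf] if it is odd, so one of the two inequalities fails. *)
have neq_ab : (psi a)./2 <> (psi b)./2 by move=> e; apply: Sb; rewrite /= -e.
have neq_ab' : uphalf (psi a') <> uphalf (psi b').
  by move=> e; apply: Sb'; rewrite /= -e.
lia.
Qed.

End main.

Theorem corollary2p5 (H : set (set nat)) (semiH : semifilter H)
    (splitH : forall phi : nat -> nat,
       finite_to_one phi -> set_surj [set: nat] [set: nat] phi ->
       exists X : set nat, H (phi @^-1` X) /\ H (phi @^-1` (~` X))) :
  [/\ ~ menger (family_space H * family_space H)%type,
      ~ scheepers (family_space H) &
      menger (family_space H) ->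
      ~ exists f : family_space H -> (family_space H * family_space H)%type,
          continuous f /\ set_surj setT setT f].
Proof.
have not_menger := split_semifilter_square_not_menger semiH splitH.
split=> //; first exact: split_semifilter_not_scheepers semiH splitH.
move=> mH [f [fcont fsurj]]; apply: not_menger.
exact: menger_surj fcont fsurj mH.
Qed.
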